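(* Let $(c_k)_{k\ge 1}$ be a nondecreasing sequence of positive real numbers, put $c_0=0$, let $p_{-1}=0$, $p_0=1$ and $p_{k+1}(x)=x\,p_k(x)-c_k\,p_{k-1}(x)$ for $k\ge 0$, and let $x_{kk}$ denote the largest zero of $p_k$. Then $$x_{kk}<2\sqrt{c_{k-1}}\qquad\text{for all } k\ge 2 .$$ Moreover, if the numbers $d_i=\frac{c_i-c_{i-1}}{c_i}\ge 0$ (with $c_0=0$) satisfy $$\frac{d_i}{2(1+d_i)}<d_{i+1}<\frac{d_i\,(1+2\sqrt{d_i}+2d_i)}{1+d_i}\qquad\text{for } i=1,2,\dots,$$ then for all $k\ge 2$, $$x_{kk}<2\sqrt{c_k\left(1-\frac{d_{k+1}^{2/3}}{\left(2^{1/3}+d_{k+1}^{1/3}\right)^2}\right)}\,.$$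
   Context: Each $p_k$ is a monic real polynomial of degree $k$, belonging to a family of symmetric orthogonal polynomials ($p_k(-x)=(-1)^kp_k(x)$); all its zeros are real and simple. *)

(* Defs.v *)
(* MathComp / MathComp-Analysis *)
From mathcomp Require Import all_boot all_order all_algebra.
From mathcomp Require Import reals exp.

Set Implicit Arguments.
Unset Strict Implicit.
Unset Printing Implicit Defensive.

Import Order.TTheory GRing.Theory Num.Theory.
Local Open Scope ring_scope.

(* p_(k+1) = x p_k - c_k p_(k-1); the inner match supplies p_(k-1), with the
   value p_(-1) = 0 when k = 0. *)
Fixpoint orthopoly (R : realType) (c : nat -> R) (n : nat) : {poly R} :=
  match n with
  | 0%N => 1
  | k.+1 => 'X * orthopoly c k
            - c k *: match k with 0%N => 0 | j.+1 => orthopoly c j end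
  end.

(* All zeros of the polynomials considered are real, so the largest zero is the
   largest one in R. *)
Definition largest_zero (R : realType) (p : {poly R}) (x : R) : Prop :=
  root p x /\ (forall y : R, root p y -> y <= x).

(* Meant for 1 <= i only: i.-1 is then the usual predecessor. *)
Definition rel_incr (R : realType) (c : nat -> R) (i : nat) : R :=
  (c i - c i.-1) / c i.

(* Main.v *)
(* Fix x at or above the claimed bound and put 4 c_j = (1 + e_j) x^2; then e_j
   is nondecreasing and v_j = 2 p_j / (x p_(j-1)) - 1 satisfies
   v_(j+1) = (v_j - e_j) / (1 + v_j).  While e_j <= 0 every v_j stays positive,
   which is already the first bound.  For e_j > 0 the linear lower bound
   v_j > - e_j / S with a fixed S persists as soon as
   e_j (S^2 + e_j) <= d_(j+1) (S - e_j).  Taking S^3 = d_(k+1) / 2, the second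
   bound says e_k <= S^2 / (1 + 2 S), which gives this condition at j = k; the
   upper bound on the growth of the d_i carries it down to all smaller j. *)
Require Import Defs.
From mathcomp Require Import all_boot all_order all_algebra.
From mathcomp Require Import reals exp.
From mathcomp Require Import ring lra.

Set Implicit Arguments.
Unset Strict Implicit.
Unset Printing Implicit Defensive.

Import Order.TTheory GRing.Theory Num.Theory.
Local Open Scope ring_scope.

(* [h j] stands for the positive part of e_j, so [inv] below is v_j > - h_j / S
   cleared of denominators. *)
Lemma orthopoly_gt0 (R : realType) (c h : nat -> R) (x S : R) (k : nat) :
  0 < x -> 0 < S ->
  (forall j, (1 <= j <= k.+1)%N -> 0 <= h j < S) ->
  (forall j, (1 <= j <= k)%N ->
    4 * c j <= (1 + h j) * x ^+ 2
    /\ S ^+ 2 * (1 + h j) <= (S - h j) * (S + h j.+1)) ->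
  0 < (orthopoly c k.+1).[x].
Proof.
move=> x0 S0 hS step.
have xS0 : 0 < x * S by exact: mulr_gt0.
suff inv j : (j <= k)%N -> 0 < (orthopoly c j).[x] /\
    (S - h j.+1) * x * (orthopoly c j).[x] < 2 * S * (orthopoly c j.+1).[x].
  have [pk lb] := inv k (leqnn k).
  have /andP[_ hkS] : 0 <= h k.+1 < S by apply: hS; rewrite leqnn.
  have := mulr_gt0 (mulr_gt0 _ x0) pk.
  move=> /(_ (S - h k.+1)); rewrite subr_gt0 => /(_ hkS) lb0.
  by have := lt_trans lb0 lb; rewrite pmulr_rgt0 // mulr_gt0.
elim: j => [_|j IH jk].
  have /andP[h0 _] : 0 <= h 1%N < S by exact: hS.
  rewrite /= !hornerE; split=> //.
  have := mulr_ge0 h0 (ltW x0); nra.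
have [pj lb] := IH (ltnW jk).
have /andP[h0 hltS] : 0 <= h j.+1 < S by apply: hS; rewrite /= ltnS ltnW.
have /andP[h'0 _] : 0 <= h j.+2 < S by exact: hS.
have [cj hh] := step j.+1 jk.
have -> : (orthopoly c j.+2).[x] =
    x * (orthopoly c j.+1).[x] - c j.+1 * (orthopoly c j).[x].
  by rewrite [orthopoly c j.+2]/= !hornerE.
move: (orthopoly c j).[x] (orthopoly c j.+1).[x] pj lb => p q p0 lb.
have xp0 : 0 < x * p by exact: mulr_gt0.
have q0 : 0 < q.
  have lb0 : 0 < (S - h j.+1) * x * p.
    by rewrite -mulrA mulr_gt0 // subr_gt0.
  by have := lt_trans lb0 lb; rewrite pmulr_rgt0 // mulr_gt0.
split=> //.
(* By the recurrence this is the next instance of the invariant. The first half of [step] bounds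
   [c j.+1] from above, the old invariant bounds [q] from below, and the second half of [step] links
   the two. *)
suff : 2 * S * (c j.+1 * p) < (S + h j.+2) * (x * q) by nra.
have a1 : 4 * c j.+1 * p <= (1 + h j.+1) * x ^+ 2 * p by rewrite ler_pM2r.
have a2 : S ^+ 2 * (1 + h j.+1) * (x * p)
    <= (S - h j.+1) * (S + h j.+2) * (x * p) by rewrite ler_pM2r.
have a3 : (S - h j.+1) * x * p * (S + h j.+2) < 2 * S * q * (S + h j.+2).
  by rewrite ltr_pM2r // ltr_wpDr.
have a4 : S * (1 + h j.+1) * (x * p) < 2 * q * (S + h j.+2).
  by rewrite -(ltr_pM2l S0); nra.
have a5 : S * (1 + h j.+1) * (x * p) * x < 2 * q * (S + h j.+2) * x.
  by rewrite ltr_pM2r.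
have a6 : S * (4 * c j.+1 * p) <= S * ((1 + h j.+1) * x ^+ 2 * p).
  by rewrite ler_pM2l.
nra.
Qed.

(* AM-GM in the form [2 S u <= S^2 + u^2] with [u = sqrt d] absorbs the term
   [2 sqrt d] of the growth bound on [d']. *)
Lemma violation_propagates (R : realType) (S eta eta' d d' : R) :
  0 < S -> S <= 1 -> 0 < eta -> 0 <= d -> d < 1 -> 0 <= d' ->
  eta' * (1 - d) = eta + d -> eta' < S ^+ 2 ->
  d' < d * (1 + 2 * Num.sqrt d + 2 * d) / (1 + d) ->
  d * (S - eta) < eta * (S ^+ 2 + eta) ->
  d' * (S - eta') < eta' * (S ^+ 2 + eta').
Proof.
move=> S0 S1 e0 d0 d1 d'0 eE eS d'lt viol.
have u0 := sqrtr_ge0 d; have uE := sqr_sqrtr d0.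
move: (Num.sqrt d) u0 uE d'lt => u u0 uE d'lt.
have d1p : 0 < 1 + d by lra.
have {}d'lt : d' * (1 + d) < d * (1 + 2 * u + 2 * d).
  by rewrite -ltr_pdivlMr.
have S2S : S ^+ 2 <= S by nra.
(* It suffices to prove the goal with [eta'] lowered to [eta + d]: this raises the left side and
   lowers the right side. *)
have e'z : eta + d <= eta' by nra.
(* Rewritten, [viol] says [d * S < eta * (S ^+ 2 + eta + d)], and the last factor is below 2. *)
have dS : d * S <= 2 * eta by nra.
have amgm : 2 * u * S <= S ^+ 2 + d by have := sqr_ge0 (S - u); nra.
have z1 : d' * (S - eta') <= d' * (S - (eta + d)) by nra.
have z2 : (eta + d) * (S ^+ 2 + (eta + d)) <= eta' * (S ^+ 2 + eta') by nra.
apply: le_lt_trans z1 _; apply: lt_le_trans _ z2.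
rewrite -(ltr_pM2r d1p).
have Sz : 0 <= S - (eta + d) by lra.
have b1 : d' * (1 + d) * (S - (eta + d))
   <= d * (1 + 2 * u + 2 * d) * (S - (eta + d)) by rewrite ler_wpM2r // ltW.
have b2 : d * (S - eta) * (1 + d) < eta * (S ^+ 2 + eta) * (1 + d).
  by rewrite ltr_pM2r.
(* The factor [d * (S ^+ 2 + 2 * eta + d)] is exactly the increase of [z * (S ^+ 2 + z)] from
   [z = eta] to [z = eta + d]. *)
have b3 : d * ((2 * u + d) * (S - (eta + d)))
   <= d * ((S ^+ 2 + 2 * eta + d) * (1 + d)).
  apply: ler_wpM2l => //.
  have : (2 * u + d) * (S - (eta + d)) <= (2 * u + d) * S.
    by apply: ler_wpM2l; nra.
  have := sqr_ge0 S; nra.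
nra.
Qed.

(** The index starts at 2 because [c 0 = 0] would make the first relative increment equal to 1. The
    identity yields the recursion for e_j. *)
Lemma rel_incr_bounds (R : realType) (c : nat -> R) (i : nat) :
  (forall k, (1 <= k)%N -> 0 < c k) ->
  (forall i j, (1 <= i)%N -> (i <= j)%N -> c i <= c j) ->
  (1 <= i)%N ->
  0 <= rel_incr c i.+1 < 1 /\ c i.+1 * (1 - rel_incr c i.+1) = c i.
Proof.
move=> c_pos c_mono i1; have c1 := c_pos _ i1; have c2 := c_pos i.+1 isT.
have cn0 : c i.+1 != 0 by rewrite gt_eqF.
rewrite /rel_incr /= ltr_pdivrMr // divr_ge0 ?subr_ge0 ?c_mono ?(ltW c2) //=.
by split; [lra | field].
Qed.

(** The second bound freed of roots: since [1 - S^2 / (1 + S)^2 = (1 + 2 S) / (1 + S)^2], the last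
    hypothesis says that x^2 is at least [4 c_(k+1) (1 - S^2 / (1 + S)^2)]. *)
Lemma orthopoly_gt0_rel_incr (R : realType) (c : nat -> R) (x S : R) (k : nat) :
  (forall k, (1 <= k)%N -> 0 < c k) ->
  (forall i j, (1 <= i)%N -> (i <= j)%N -> c i <= c j) ->
  (forall i, (1 <= i)%N -> rel_incr c i.+1
     < rel_incr c i * (1 + 2 * Num.sqrt (rel_incr c i) + 2 * rel_incr c i)
       / (1 + rel_incr c i)) ->
  0 < x -> 0 < S -> S <= 1 -> rel_incr c k.+2 = 2 * S ^+ 3 ->
  4 * c k.+1 * (1 + 2 * S) <= (1 + S) ^+ 2 * x ^+ 2 ->
  0 < (orthopoly c k.+1).[x].
Proof.
move=> c_pos c_mono d_growth x0 S0 S1 dS xS.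
have x20 : 0 < x ^+ 2 by rewrite exprn_gt0.
have xn0 : x != 0 by rewrite gt_eqF.
pose e j := 4 * c j / x ^+ 2 - 1.
have eE j : 4 * c j = (1 + e j) * x ^+ 2 by rewrite /e; field.
have e_gt j : (1 <= j)%N -> -1 < e j.
  by move=> /c_pos cj; rewrite /e ltrBrDl subrr divr_gt0 // mulr_gt0.
have e_mono i j : (1 <= i)%N -> (i <= j)%N -> e i <= e j.
  by move=> i1 ij; rewrite lerD2r ler_pM2r ?invr_gt0 // ler_pM2l // c_mono.
have e_rec j : (1 <= j)%N ->
    e j.+1 * (1 - rel_incr c j.+1) = e j + rel_incr c j.+1.
  move=> /(rel_incr_bounds c_pos c_mono)[_ cE].
  by rewrite /e -cE; field.
have ek : e k.+1 * (1 + 2 * S) <= S ^+ 2.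
  have := xS; rewrite eE -(ler_pM2r x20) => H.
  have {H} : (1 + e k.+1) * (1 + 2 * S) * x ^+ 2 <= (1 + S) ^+ 2 * x ^+ 2.
    by rewrite mulrAC -eE.
  by rewrite ler_pM2r //; nra.
have ekS : e k.+1 < S ^+ 2.
  have S20 : 0 < S ^+ 2 by rewrite exprn_gt0.
  have w0 : 0 < 1 + 2 * S by lra.
  by rewrite -(ltr_pM2r w0); nra.
have e_lt j : (1 <= j <= k.+1)%N -> e j < S ^+ 2.
  by move=> /andP[j1 jk]; apply: le_lt_trans ekS; exact: e_mono.
have S2S : S ^+ 2 <= S by rewrite expr2; nra.
(* Argue by contraposition: a violation at any j would climb, one index at a time, up to [k.+1],
   where the choice of [S] excludes it. *)
pose bad j := 0 < e j
  /\ rel_incr c j.+1 * (S - e j) < e j * (S ^+ 2 + e j).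
have bad_up j m : (1 <= j)%N -> (j + m <= k.+1)%N -> bad j -> bad (j + m)%N.
  move=> j1; elim: m => [|m IH]; rewrite ?addn0 // addnS => jmk bj.
  have [e0 viol] := IH (ltnW jmk) bj.
  have jm1 : (1 <= j + m)%N by rewrite ltn_addr.
  have [/andP[d0 d1] _] := rel_incr_bounds c_pos c_mono jm1.
  have [/andP[d'0 _] _] := rel_incr_bounds c_pos c_mono (leqW jm1).
  split; first by apply: lt_le_trans e0 _; apply: e_mono.
  apply: (violation_propagates S0 S1 e0 d0 d1 d'0 (e_rec _ jm1)) => //.
  - by apply: e_lt; rewrite jmk.
  - exact: d_growth.
have not_bad j : (1 <= j <= k.+1)%N -> ~ bad j.
  move=> /andP[j1 jk] bj.
  have := bad_up j (k.+1 - j)%N j1; rewrite subnKC // leqnn => /(_ isT bj)[e0].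
  rewrite dS => viol.
  have a1 : e k.+1 * (S ^+ 2 + e k.+1) * (1 + 2 * S)
      <= S ^+ 2 * (S ^+ 2 + e k.+1).
    rewrite mulrAC ler_wpM2r //; have := sqr_ge0 S; lra.
  have w0 : 0 < 1 + 2 * S by lra.
  have a2 : 2 * S ^+ 3 * (S - e k.+1) * (1 + 2 * S)
      < e k.+1 * (S ^+ 2 + e k.+1) * (1 + 2 * S) by rewrite ltr_pM2r.
  have a3 : S ^+ 3 * (e k.+1 * (1 + 2 * S)) <= S ^+ 3 * S ^+ 2.
    by rewrite ler_pM2l ?exprn_gt0.
  have a4 : 0 < S ^+ 2 by rewrite exprn_gt0.
  (* Cancelling [S ^+ 2] leaves [S^2 + 2 S^3 < e_(k+1)], against [ekS]. *)
  have : S ^+ 2 * (2 * S * (S * (1 + 2 * S)) - 2 * S * S ^+ 2)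
      < S ^+ 2 * (S ^+ 2 + e k.+1) by nra.
  rewrite ltr_pM2l //; nra.
apply: (@orthopoly_gt0 _ c (fun j => Num.max 0 (e j)) x S) => // j jk.
  rewrite le_max lexx /= gt_max S0 /=.
  by apply: lt_le_trans S2S; exact: e_lt.
have /andP[j1 jk'] := jk.
split.
  by rewrite eE ler_pM2r // lerD2l le_max lexx orbT.
have [ej0|ej0] := lerP (e j) 0.
  have : 0 <= Num.max 0 (e j.+1) by rewrite le_max lexx.
  by nra.
have ej'0 : 0 < e j.+1 by apply: lt_le_trans ej0 _; exact: e_mono.
rewrite (max_r (ltW ej'0)).
have [/andP[d0 d1] _] := rel_incr_bounds c_pos c_mono j1.
have good : e j * (S ^+ 2 + e j) <= rel_incr c j.+1 * (S - e j).
  rewrite leNgt; apply/negP => viol.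
  by apply: (@not_bad j) => //; rewrite j1 leqW.
have d1p : 0 < 1 - rel_incr c j.+1 by lra.
have rec := e_rec _ j1.
have := e_lt j; rewrite j1 leqW // => /(_ isT) ejS.
rewrite -(ler_pM2r d1p).
have -> : (S - e j) * (S + e j.+1) * (1 - rel_incr c j.+1)
  = (S - e j) * (S * (1 - rel_incr c j.+1) + (e j + rel_incr c j.+1)).
  by rewrite -rec; ring.
(* After multiplication by [1 - d_(j+1)], the two sides of the goal differ by the slack in [good]
   plus exactly this term. *)
have : 0 <= S * e j * rel_incr c j.+1 * (1 + S).
  have S10 : 0 <= 1 + S by lra.
  exact: mulr_ge0 (mulr_ge0 (mulr_ge0 (ltW S0) (ltW ej0)) d0) S10.
nra.
Qed.

Theorem theorem1 (R : realType) (c : nat -> R)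
    (c_0 : c 0%N = 0)
    (c_pos : forall k : nat, (1 <= k)%N -> 0 < c k)
    (c_nondecr : forall i j : nat, (1 <= i)%N -> (i <= j)%N -> c i <= c j) :
  (forall (k : nat) (x : R), (2 <= k)%N -> largest_zero (orthopoly c k) x ->
     x < 2 * Num.sqrt (c k.-1))
  /\
  ((forall i : nat, (1 <= i)%N ->
      rel_incr c i / (2 * (1 + rel_incr c i)) < rel_incr c i.+1
      /\ rel_incr c i.+1
         < rel_incr c i * (1 + 2 * Num.sqrt (rel_incr c i) + 2 * rel_incr c i)
           / (1 + rel_incr c i)) ->
   forall (k : nat) (x : R), (2 <= k)%N -> largest_zero (orthopoly c k) x ->
     x < 2 * Num.sqrt
       (c k * (1 - rel_incr c k.+1 `^ (2 / 3)
                   / (2 `^ (1 / 3) + rel_incr c k.+1 `^ (1 / 3)) ^+ 2))).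
Proof.
split=> [[|[|k]] x // _ [/rootP px _]|growth [|[|k]] x // _ [/rootP px _]].
  rewrite ltNge; apply/negP => lex.
  have ck : 0 < c k.+1 by exact: c_pos.
  have s0 : 0 < Num.sqrt (c k.+1) by rewrite sqrtr_gt0.
  have sE := sqr_sqrtr (ltW ck).
  have x0 : 0 < x by apply: lt_le_trans lex; rewrite mulr_gt0.
  suff : 0 < (orthopoly c k.+2).[x] by rewrite px ltxx.
  (* Here every relevant e_j is nonpositive, so [h = 0] serves, and any positive [S] would do. *)
  apply: (@orthopoly_gt0 _ c (fun=> 0) x 1) => // [j _|j /andP[j1 jk]].
    by rewrite lexx ltr01.
  have := c_nondecr _ _ j1 jk; rewrite /= in lex s0 sE *.
  by split; nra.
rewrite ltNge; apply/negP => lex.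
have [/andP[d0 d1] _] := rel_incr_bounds c_pos c_nondecr (isT : (1 <= k.+2)%N).
(* A zero increment would, by the upper growth bound, force the next one to be negative. *)
have dpos : 0 < rel_incr c k.+3.
  rewrite lt_neqAle d0 andbT; apply/eqP => dE.
  have [/andP[d'0 _] _] := rel_incr_bounds c_pos c_nondecr (isT : (1 <= k.+3)%N).
  have [_] := growth k.+3 isT.
  by rewrite -dE !mul0r ltNge d'0.
have cube (a : R) : 0 <= a -> (a `^ (1 / 3)) ^+ 3 = a.
  move=> a0; rewrite -powR_mulrn ?powR_ge0 // -powRrM.
  by have -> : 1 / 3 * 3%:R = 1 :> R; [field | rewrite powRr1].
have DE := cube _ d0; have TE : (2 `^ (1 / 3)) ^+ 3 = 2 :> R by exact: cube.
have sq : rel_incr c k.+3 `^ (2 / 3) = (rel_incr c k.+3 `^ (1 / 3)) ^+ 2.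
  rewrite -powR_mulrn ?powR_ge0 // -powRrM.
  by congr (_ `^ _); field.
have D0 : 0 < rel_incr c k.+3 `^ (1 / 3) by exact: powR_gt0.
have T0 : 0 < 2 `^ (1 / 3) :> R by exact: powR_gt0.
move: lex; rewrite sq.
move: (rel_incr c k.+3 `^ _) (2 `^ _) D0 T0 DE TE {sq} => D T D0 T0 DE TE lex.
have Tn0 : T != 0 by rewrite gt_eqF.
pose S := D / T.
have S0 : 0 < S by exact: divr_gt0.
have dS : rel_incr c k.+3 = 2 * S ^+ 3.
  by rewrite /S -DE -TE; field.
(* Indeed [S ^+ 3] is half of an increment smaller than 1. *)
have S1 : S <= 1.
  rewrite leNgt; apply/negP => S1; have : 1 < S ^+ 3 by rewrite exprn_egt1 ?ltW.
  lra.
have S1n0 : 1 + S != 0 by rewrite gt_eqF // ltr_wpDl.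
have DS : D ^+ 2 / (T + D) ^+ 2 = S ^+ 2 / (1 + S) ^+ 2.
  rewrite /S; field; rewrite Tn0 /=.
  by rewrite gt_eqF // addr_gt0.
have ck : 0 < c k.+2 by exact: c_pos.
have wE : c k.+2 * (1 - S ^+ 2 / (1 + S) ^+ 2) * (1 + S) ^+ 2
    = c k.+2 * (1 + 2 * S) by field.
move: lex; rewrite DS; set w := c k.+2 * _ in wE *.
have w0 : 0 < w.
  rewrite -(@pmulr_lgt0 _ ((1 + S) ^+ 2)) ?exprn_gt0 ?addr_gt0 // wE.
  by rewrite mulr_gt0 // addr_gt0 // mulr_gt0.
move=> lex.
have s0 : 0 < Num.sqrt w by rewrite sqrtr_gt0.
have sE := sqr_sqrtr (ltW w0).
have x0 : 0 < x by apply: lt_le_trans lex; rewrite mulr_gt0.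
suff : 0 < (orthopoly c k.+2).[x] by rewrite px ltxx.
apply: (orthopoly_gt0_rel_incr c_pos c_nondecr _ x0 S0 S1 dS).
  by move=> i /growth[].
have xw : 4 * w <= x ^+ 2 by nra.
rewrite -mulrA -wE mulrA mulrC ler_wpM2l ?sqr_ge0 //.
Qed.
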